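(* Let $D=\partial_{x_1}+(a(x_1)x_2+b(x_1))\partial_{x_2}$ be a Shamsuddin derivation of $K[x_1,x_2]$, where $a(x_1),b(x_1)\in K[x_1]$. Then the following two statements are equivalent: (1) $D$ is a simple derivation; (2) $\operatorname{Aut}(K[x_1,x_2])_D=\{\mathrm{id}\}$.
   Context: $K$ is a field of characteristic zero and $\partial_{x_i}=\partial/\partial x_i$. A $K$-derivation $D$ of $K[x_1,x_2]$ is a $K$-linear map with $D(ab)=D(a)b+aD(b)$. A Shamsuddin derivation of $K[x_1,x_2]$ is a derivation of the form $\partial_{x_1}+(ax_2+b)\partial_{x_2}$ with $a,b\in K[x_1]$. An ideal $I$ is $D$-stable if $D(I)\subset I$; $D$ is simple if the only $D$-stable ideals of $K[x_1,x_2]$ are $0$ and $K[x_1,x_2]$. $\operatorname{Aut}(K[x_1,x_2])$ is the group of $K$-algebra automorphisms of $K[x_1,x_2]$ and $\operatorname{Aut}(K[x_1,x_2])_D=\{\rho\in\operatorname{Aut}(K[x_1,x_2]) : \rho D=D\rho\}$. *)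

(* Defs.v *)
From mathcomp Require Import all_boot all_order all_algebra.
From mathcomp Require Export mpoly.

Set Implicit Arguments.
Unset Strict Implicit.
Unset Printing Implicit Defensive.

Import GRing.Theory.
Local Open Scope ring_scope.

(* The variables x_1, x_2 of K[x_1, x_2] are 'X_0 and 'X_1, as indices start
   at 0 in {mpoly K[2]}. *)
Definition x1 (K : fieldType) : {mpoly K[2]} := 'X_(0 : 'I_2).
Definition x2 (K : fieldType) : {mpoly K[2]} := 'X_(1 : 'I_2).

Definition is_derivation (K : fieldType) (D : {mpoly K[2]} -> {mpoly K[2]}) :=
  linear D /\ forall p q, D (p * q) = D p * q + p * D q.

(* horner_alg (x1 K) a is a(x_1), a : {poly K} seen inside K[x_1, x_2]. *)
Definition shamsuddin (K : fieldType) (a b : {poly K}) (p : {mpoly K[2]}) :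
    {mpoly K[2]} :=
  p^`M(0 : 'I_2)
  + (horner_alg (x1 K) a * x2 K + horner_alg (x1 K) b) * p^`M(1 : 'I_2).

Lemma shamsuddin_derivation (K : fieldType) (a b : {poly K}) :
  is_derivation (shamsuddin a b).
Proof.
rewrite /shamsuddin; split=> [c p q | p q].
  by rewrite !linearP /= mulrDr scalerDr -scalerAr addrACA.
move: (horner_alg _ a * _ + _) => c.
by rewrite !mderivM !mulrDr mulrDl addrACA -(mulrA c) (mulrCA p c).
Qed.

(* Ideals are Prop-valued: an arbitrary subset need not be decidable. *)
Record is_ideal (R : comNzRingType) (I : R -> Prop) : Prop := IsIdeal {
  ideal_zero : I 0;
  ideal_add : forall p q, I p -> I q -> I (p + q);
  ideal_mul : forall r p, I p -> I (r * p)
}.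

Definition stable (R : Type) (D : R -> R) (I : R -> Prop) :=
  forall p, I p -> I (D p).

Definition simple_derivation (K : fieldType)
    (D : {mpoly K[2]} -> {mpoly K[2]}) :=
  forall I : {mpoly K[2]} -> Prop, is_ideal I -> stable D I ->
    (forall p, I p <-> p = 0) \/ (forall p, I p).

(* Membership in Aut(K[x_1, x_2])_D of a K-algebra endomorphism rho. *)
Definition in_Aut_D (K : fieldType) (D : {mpoly K[2]} -> {mpoly K[2]})
    (rho : {lrmorphism {mpoly K[2]} -> {mpoly K[2]}}) :=
  bijective rho /\ forall p, rho (D p) = D (rho p).

(* Main.v *)
Require Import Defs.
From mathcomp Require Import all_boot all_order all_algebra.
From HB Require Import structures.
From mathcomp Require Import ring.
From Stdlib Require Import Classical.
Import GRing.Theory.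
Local Open Scope ring_scope.

(** Write x, y for x_1, x_2.  Both sides of the equivalence say that the
    linear differential equation h' = a h + b has no solution h in K[x].

    If h is such a solution, the curve y = h(x) is invariant: restricting a
    polynomial to it turns D into d/dx, so the polynomials that vanish on it
    form a proper nonzero stable ideal ([solution_not_simple]).  Moreover
    D(y - h) = a (y - h), so scaling y - h by 2, with x fixed, is a nontrivial
    automorphism that commutes with D ([solution_nontrivial_aut]).

    Suppose that there is no solution.  If a stable ideal contains p <> 0 of
    y-degree d, it contains D p - d a p, whose coefficient in y^d is the
    derivative of the leading coefficient of p.  Repeating this lowers that
    coefficient to a constant and then lowers the y-degree; it stops only at a
    unit, or when D p = d a p with d > 0 and p of constant leading
    coefficient.  In the latter case the coefficient of y^(d-1) in p is, up to
    a constant factor, a solution.  Hence D is simple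
    ([no_solution_simple]).

    Suppose again that there is no solution, and let rho commute with D.  Then
    D (rho x) = 1 and D (rho y) = a(rho x) rho y + b(rho x).  A comparison of
    leading coefficients in y gives first rho x = x + k, then rho y of degree
    1 in y, and a(x + k) = a(x).  In characteristic 0 this forces k = 0, as
    the equation can be solved when a is constant; the remaining coefficients
    of rho y can only be those of y, as anything else would yield a solution
    ([derivative_one_translate], [semiconjugate_trivial]).

    The y-degree arguments take place in K[x][y], encoded as
    {poly {poly K}}. *)

(** * The equation h' = a h + b in K[x] *)

Section CharZero.

Set Implicit Arguments.
Unset Strict Implicit.
Unset Printing Implicit Defensive.

Variable K : fieldType.
Hypothesis charK0 : [pchar K] =i pred0.
Implicit Types (a b c h u : {poly K}) (p q : {poly {poly K}}).

Definition ode_solution a b h := h^`() = a * h + b.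

Definition no_ode_solution a b := forall h, ~ ode_solution a b h.

Lemma deriv_eq0_char0 u : u^`() = 0 -> u = (u`_0)%:P.
Proof.
move=> du0; apply/polyP=> -[|i]; rewrite coefC //=.
have := congr1 (fun v : {poly K} => v`_i) du0; rewrite coef_deriv coef0 => /eqP.
by rewrite -mulr_natr mulf_eq0 ((pcharf0P K).1 charK0) orbF => /eqP.
Qed.

(** Degrees: u' is smaller than u, while c u is not unless c = 0. *)
Lemma deriv_eq_mul c u : u != 0 -> u^`() = c * u -> c = 0.
Proof.
move=> u0 du; apply/eqP; apply: contraTT (lt_size_deriv u0) => c0.
rewrite du -leqNgt size_mul //; case: (size c) (size_poly_eq0 c) => [|n _].
  by rewrite (negPf c0).
by rewrite addSn leq_addl.
Qed.

Lemma primitive_exists b : exists h, h^`() = b.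
Proof.
exists (\poly_(i < (size b).+1) (b`_i.-1 / i%:R)); apply/polyP=> i.
rewrite coef_deriv coef_poly ltnS /=; case: ltnP => [_|lebi].
  by rewrite -[LHS]mulr_natr divfK // ((pcharf0P K).1 charK0).
by rewrite mul0rn nth_default.
Qed.

(** For k <> 0 this is the terminating series
    h = - b / k - b' / k^2 - b'' / k^3 - ..., summed by induction on the
    degree of b. *)
Lemma const_ode_solution k b : exists h, ode_solution k%:P b h.
Proof.
rewrite /ode_solution; have [->|k0] := eqVneq k 0.
  by have [h <-] := primitive_exists b; exists h; rewrite mul0r add0r.
have [n] := ubnP (size b); elim: n b => // n IHn b szb.
have [->|b0] := eqVneq b 0; first by exists 0; rewrite derivC mulr0 addr0.
have [|g dg] := IHn (k^-1 *: b^`()).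
  by rewrite size_scale ?invr_eq0 //; apply: leq_trans (lt_size_deriv b0) _.
exists (g - k^-1 *: b).
rewrite derivB derivZ dg addrK mulrBr -scalerAr -mul_polyC mulrA -polyCM.
by rewrite mulVf // mul1r subrK.
Qed.

Lemma coef_not_const a b k : no_ode_solution a b -> a <> k%:P.
Proof.
by move=> ns ak; have [h] := const_ode_solution k b; rewrite -ak => /ns.
Qed.

(** A periodic polynomial takes its value at 0 at all the multiples of its
    period, which are infinitely many in characteristic 0. *)
Lemma comp_shift_eq a k : k != 0 -> a \Po ('X + k%:P) = a -> a = (a`_0)%:P.
Proof.
move=> k0 ak.
have aE n : a.[k *+ n] = a.[0].
  elim: n => [//|n IHn]; rewrite -IHn -[in RHS]ak horner_comp !hornerE.
  by rewrite mulrSr.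
suff: a - (a.[0])%:P = 0 by move/subr0_eq => {1}->; rewrite horner_coef0.
apply: (@roots_geq_poly_eq0 _ _
  [seq k *+ i | i <- iota 0 (size (a - (a.[0])%:P))]).
- by apply/allP=> _ /mapP[i _ ->]; rewrite rootE !hornerE aE subrr.
- rewrite map_inj_uniq ?iota_uniq // => i j /eqP.
  wlog leij : i j / (i <= j)%N => [W|].
    case/orP: (leq_total i j) => [/W//|/W Wji /eqP e].
    by apply/esym/Wji; rewrite e.
  rewrite eq_sym -subr_eq0 -mulrnBr // -mulr_natr mulf_eq0 (negPf k0) /=.
  rewrite ((pcharf0P K).1 charK0) subn_eq0 => leji.
  by apply/eqP; rewrite eqn_leq leij.
- by rewrite size_map size_iota.
Qed.

(** * The derivation on K[x][y] *)

Definition shamsuddinY a b p :=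
  map_poly (@deriv K) p + (a%:P * 'X + b%:P) * p^`().

Lemma coef_shamsuddinY a b p i :
  (shamsuddinY a b p)`_i =
    (p`_i)^`() + a * (p`_i *+ i) + b * (p`_i.+1 *+ i.+1).
Proof.
rewrite coefD coef_map /= mulrDl coefD -mulrA !coefCM coefXM !coef_deriv addrA.
by case: i => [|i] //=; rewrite mulr0n.
Qed.

Lemma map_derivM p q :
  map_poly (@deriv K) (p * q) =
    map_poly (@deriv K) p * q + p * map_poly (@deriv K) q.
Proof.
apply/polyP=> i; rewrite coefD !(coefM, coef_map) /= raddf_sum -big_split /=.
by apply: eq_bigr => j _; rewrite derivM !coef_map.
Qed.

Lemma shamsuddinYM a b p q :
  shamsuddinY a b (p * q) = shamsuddinY a b p * q + p * shamsuddinY a b q.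
Proof. by rewrite /shamsuddinY map_derivM derivM; ring. Qed.

Lemma shamsuddinYD a b p q :
  shamsuddinY a b (p + q) = shamsuddinY a b p + shamsuddinY a b q.
Proof. by rewrite /shamsuddinY raddfD derivD /=; ring. Qed.

Lemma shamsuddinYC a b c : shamsuddinY a b c%:P = c^`()%:P.
Proof. by rewrite /shamsuddinY map_polyC derivC mulr0 addr0. Qed.

Lemma shamsuddinYX a b : shamsuddinY a b 'X = a%:P * 'X + b%:P.
Proof.
rewrite /shamsuddinY derivX mulr1; apply/polyP=> i.
by rewrite coefD coef_map /= coefX; case: (i == 1)%N; rewrite derivC add0r.
Qed.

(** The chain rule along the curve y = h(x), which is tangent to the
    derivation. *)
Lemma horner_shamsuddinY a b h p : ode_solution a b h ->
  (shamsuddinY a b p).[h] = p.[h]^`().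
Proof.
move=> hP; elim/poly_ind: p => [|p c IHp].
  by rewrite /shamsuddinY map_poly0 derivC mulr0 addr0 !horner0 derivC.
rewrite shamsuddinYD shamsuddinYM shamsuddinYC shamsuddinYX.
move: (shamsuddinY a b p) IHp => s IHp.
by rewrite !hornerE IHp derivD derivM hP; ring.
Qed.

(** Descent, lexicographically on the y-degree d of p and on the x-degree of
    its leading coefficient: D p - d a p is smaller than p, since the
    contribution d a of the term a y d/dy to the top coefficient cancels and
    only the derivative of that coefficient is left. *)
Lemma stable_descent a b (I : {poly {poly K}} -> Prop) p :
  is_ideal I -> stable (shamsuddinY a b) I -> I p -> p != 0 ->
  I 1 \/ exists h, ode_solution a b h.
Proof.
move=> II SI.
have [n] := ubnP (size p); elim: n p => // n IHn p szp.
have [m] := ubnP (size (lead_coef p)).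
elim: m p szp => // m IHm p szp szc Ip p0.
have lp0 : lead_coef p != 0 by rewrite lead_coef_eq0.
set d := (size p).-1.
have szpE : size p = d.+1 by rewrite /d prednK // lt0n size_poly_eq0.
pose q := shamsuddinY a b p - (a *+ d)%:P * p.
have Iq : I q.
  rewrite /q -mulNr.
  by apply: (ideal_add II); [apply: SI|apply: (ideal_mul II)].
have qE i : q`_i =
    (p`_i)^`() + a * (p`_i *+ i) + b * (p`_i.+1 *+ i.+1) - a *+ d * p`_i.
  by rewrite coefB coef_shamsuddinY coefCM.
have qd : q`_d = (lead_coef p)^`().
  rewrite qE [p`_d.+1]nth_default ?szpE // mul0rn mulr0 addr0 lead_coefE -/d.
  by rewrite mulrnAr mulrnAl addrK.
have szq : (size q <= d.+1)%N.
  apply/leq_sizeP=> i ltdi; rewrite qE !nth_default ?szpE // 1?ltnW //.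
  by rewrite derivC !mul0rn !mulr0 !addr0 subr0.
(* As long as the leading coefficient is not constant, q has the same y-degree
   as p and a leading coefficient of smaller x-degree. *)
have [dl0|dl0] := eqVneq (lead_coef p)^`() 0; last first.
  have szqE : size q = d.+1.
    apply/eqP; rewrite eqn_leq szq ltnNge.
    apply/negP=> /leq_sizeP/(_ d (leqnn _)).
    by rewrite qd => /eqP; rewrite (negPf dl0).
  apply: (IHm q) => //; first by rewrite szqE -szpE.
    rewrite lead_coefE szqE qd; apply: leq_trans (lt_size_deriv lp0) _.
    by rewrite -ltnS.
  by rewrite -size_poly_eq0 szqE.
have [q0|q0] := eqVneq q 0; last first.
  apply: (IHn q) => //; apply: (@leq_ltn_trans d); last by rewrite -ltnS -szpE.
  apply/leq_sizeP=> i; rewrite leq_eqVlt => /predU1P[<-|]; first by rewrite qd.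
  by move/leq_sizeP: szq; apply.
pose k := (lead_coef p)`_0.
have kE : p`_d = k%:P by rewrite /d -lead_coefE (deriv_eq0_char0 dl0).
have k0 : k != 0.
  by apply: contraNneq lp0 => k0; rewrite lead_coefE -/d kE k0.
case: d szpE @q szq qd Iq qE q0 kE => [|d] szpE q szq qd Iq qE q0 kE.
  left; have -> : 1 = (k^-1)%:P%:P * p; last exact: (ideal_mul II).
  by rewrite [p]size1_polyC ?szpE // kE -!polyCM mulVf.
have dk0 : d.+1%:R * k != 0 by rewrite mulf_neq0 // ((pcharf0P K).1 charK0).
(* D p = (d + 1) a p; the coefficients of y^d give u' = a u - (d + 1) k b for
   u the coefficient of y^d in p. *)
right.
exists (- (d.+1%:R * k)^-1 *: p`_d).
have := qE d; rewrite q0 coef0 kE => e.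
have {e} : (p`_d)^`() = a * p`_d - b * (d.+1%:R * k)%:P.
  by apply/subr0_eq; rewrite [RHS]e polyCM polyC_natr; ring.
rewrite /ode_solution derivZ => ->.
rewrite scalerBr -scalerAr; congr (_ + _).
by rewrite scaleNr opprK (mulrC b) mul_polyC scalerA mulVf ?scale1r.
Qed.

(** * Rigidity in the absence of solutions *)

(** The leading coefficient c satisfies c' + d a c = A c, where d > 0 is the
    y-degree of p, so that c is constant by [deriv_eq_mul]. *)
Lemma affine_eq_lead_coef a b (A B : {poly K}) p : (1 < size p)%N ->
  shamsuddinY a b p = A%:P * p + B%:P ->
  (lead_coef p)^`() = 0 /\ A = a *+ (size p).-1.
Proof.
move=> szp e; have p0 : p != 0 by rewrite -size_poly_gt0 ltnW.
have := congr1 (fun q : {poly {poly K}} => q`_(size p).-1) e.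
rewrite coef_shamsuddinY coefD coefCM coefC.
rewrite [p`_(_.-1.+1)]nth_default ?prednK ?size_poly_gt0 //.
have -> : ((size p).-1 == 0)%N = false by case: (size p) szp => [|[]].
rewrite mul0rn mulr0 !addr0 mulrnAr -mulrnAl -lead_coefE => e1.
have lp0 : lead_coef p != 0 by rewrite lead_coef_eq0.
have e2 : (lead_coef p)^`() = (A - a *+ (size p).-1) * lead_coef p.
  by rewrite mulrBl -e1 addrK.
have A0 := deriv_eq_mul lp0 e2.
by rewrite e2 A0 mul0r; split=> //; apply/subr0_eq.
Qed.

(** In positive y-degree d, [affine_eq_lead_coef] would give d a = 0, although
    a <> 0. *)
Lemma derivative_one_translate a b p :
  no_ode_solution a b -> shamsuddinY a b p = 1 ->
  exists k : K, p = ('X + k%:P)%:P.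
Proof.
move=> ns e.
have a0 : a != 0 by apply/eqP=> a0; apply: (coef_not_const (k := 0) ns).
have szp : (size p <= 1)%N.
  rewrite leqNgt; apply/negP=> szp.
  have [|_ /esym/eqP] := @affine_eq_lead_coef a b 0 1 p szp.
    by rewrite mul0r add0r.
  rewrite -mulr_natr -polyC_natr mulf_eq0 (negPf a0) polyC_eq0.
  rewrite ((pcharf0P K).1 charK0).
  by case: (size p) szp => [|[]].
rewrite (size1_polyC szp) in e *; move: (p`_0) e => c.
rewrite shamsuddinYC => /polyC_inj dc.
exists (c - 'X)`_0; rewrite -deriv_eq0_char0; first by rewrite addrC subrK.
by rewrite derivB derivX dc subrr.
Qed.

(** The hypothesis says that p is the image of y under an endomorphism that
    commutes with the derivation and maps x to x + k. *)
Lemma semiconjugate_trivial a b k p : no_ode_solution a b ->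
  shamsuddinY a b p = (a \Po ('X + k%:P))%:P * p + (b \Po ('X + k%:P))%:P ->
  k = 0 /\ p = 'X.
Proof.
move=> ns e.
(* If p had no y, shifting it back by k would give a solution. *)
have szp : (1 < size p)%N.
  rewrite ltnNge; apply/negP=> szp; move: e; rewrite (size1_polyC szp).
  move: (p`_0) => c; rewrite shamsuddinYC -polyCM -polyCD => /polyC_inj dc.
  apply: (ns (c \Po ('X - k%:P))).
  have shK (u : {poly K}) : (u \Po ('X + k%:P)) \Po ('X - k%:P) = u.
    by rewrite -comp_polyA comp_polyD comp_polyX comp_polyC subrK comp_polyXr.
  rewrite /ode_solution deriv_comp derivB derivX derivC subr0 mulr1 dc.
  by rewrite comp_polyD comp_polyM !shK.
have [dl aE] := affine_eq_lead_coef szp e.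
have a0 : a != 0 by apply/eqP=> a0; apply: (coef_not_const (k := 0) ns).
(* a(x + k) and a have the same leading coefficient, and they differ by the
   factor deg p. *)
have sz2 : size p = 2%N.
  have la : lead_coef (a \Po ('X + k%:P)) = lead_coef a.
    by rewrite lead_coef_comp ?size_XaddC // lead_coefXaddC expr1n mulr1.
  move/eqP: la; rewrite aE -mulr_natr -polyC_natr lead_coefM lead_coefC.
  rewrite -subr_eq0.
  rewrite -[X in _ - X]mulr1 -mulrBr mulf_eq0 lead_coef_eq0 (negPf a0) /=.
  case: (size p) szp => [|[|n]] //= _.
  by rewrite mulrSr addrK ((pcharf0P K).1 charK0) => /eqP->.
rewrite sz2 /= mulr1n in aE.
have [k0|k0] := eqVneq k 0; last first.
  by case: (coef_not_const (k := a`_0) ns (comp_shift_eq k0 aE)).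
split=> //; move: e; rewrite k0 addr0 !comp_polyXr => e.
(* p = t y + p_0, where p_0 / (1 - t) would be a solution if t <> 1; for t = 1
   the homogeneous equation for p_0 leaves only 0. *)
pose t := (lead_coef p)`_0.
have p1 : p`_1 = t%:P by rewrite /t -(deriv_eq0_char0 dl) lead_coefE sz2.
have p0 : (p`_0)^`() = a * p`_0 + (1 - t)%:P * b.
  have := congr1 (fun q : {poly {poly K}} => q`_0) e.
  rewrite coef_shamsuddinY coefD coefCM coefC /= mulr0n mulr0 addr0 mulr1n p1.
  move=> e0.
  by apply: (addIr (b * t%:P)); rewrite e0 polyCB; ring.
have t1 : t = 1.
  apply/eqP/negP=> t1.
  have s0 : 1 - t != 0 by rewrite subr_eq0 eq_sym; apply/negP.
  apply: (ns ((1 - t)^-1 *: p`_0)).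
  rewrite /ode_solution derivZ p0 scalerDr -scalerAr.
  by rewrite mul_polyC scalerA mulVf ?scale1r.
have p00 : p`_0 = 0.
  apply/eqP; apply: contraNT a0 => p00; apply/eqP; apply: (deriv_eq_mul p00).
  by rewrite p0 t1 subrr mul0r addr0.
apply/polyP=> -[|[|i]]; rewrite coefX ?p00 ?p1 ?t1 //.
by rewrite nth_default ?sz2.
Qed.

End CharZero.

(** * The isomorphism of K[x, y] with K[x][y] *)

Section Transport.

Set Implicit Arguments.
Unset Strict Implicit.
Unset Printing Implicit Defensive.

Variable K : fieldType.
Implicit Types (a b h : {poly K}) (q : {poly {poly K}}) (p r : {mpoly K[2]}).

Local Notation X := (x1 K).
Local Notation Y := (x2 K).

Lemma ord2P (i : 'I_2) : i = 0 \/ i = 1.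
Proof. by case: i => -[|[|i]] //= lti; [left|right]; apply/val_inj. Qed.

(** Reduces identities between algebra morphisms, or between derivations, to
    the generators. *)
Lemma mpoly_gen_ind (P : {mpoly K[2]} -> Prop) :
  (forall k, P k%:A) -> P X -> P Y ->
  (forall p r, P p -> P r -> P (p + r)) ->
  (forall p r, P p -> P r -> P (p * r)) -> forall p, P p.
Proof.
move=> PC P1 P2 PD PM p; elim/mpolyind: p => [|c m p _ _ Pp].
  by rewrite -(scale0r 1).
apply: (PD) => //; rewrite -mulr_algl; apply: (PM) => //; rewrite mpolyXE_id.
apply: big_ind => [||i _]; [by rewrite -(scale1r 1)|exact: PM|].
elim: (m i) => [|n IHn]; first by rewrite expr0 -(scale1r 1).
by rewrite exprS; apply: (PM) => //; case: (ord2P i) => ->.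
Qed.

Lemma shamsuddinD a b p r :
  shamsuddin a b (p + r) = shamsuddin a b p + shamsuddin a b r.
Proof.
by case: (shamsuddin_derivation a b) => /(_ 1 p r); rewrite !scale1r.
Qed.

Lemma shamsuddinM a b p r :
  shamsuddin a b (p * r) = shamsuddin a b p * r + p * shamsuddin a b r.
Proof. by case: (shamsuddin_derivation a b). Qed.

Lemma shamsuddin_alg a b (k : K) : shamsuddin a b k%:A = 0.
Proof. by rewrite alg_mpolyC /shamsuddin !mderivC mulr0 addr0. Qed.

Lemma mderiv_var (i j : 'I_2) : ('X_j : {mpoly K[2]})^`M(i) = (i == j)%:R.
Proof.
rewrite mderivX mnm1E eq_sym; case: eqP => [->|_]; last by rewrite scale0r.
rewrite (_ : (U_(j) - U_(j))%MM = 0%MM) ?mpolyX0 ?scale1r //.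
by apply/mnmP=> k; rewrite mnmBE subnn mnm0E.
Qed.

Lemma shamsuddin_x1 a b : shamsuddin a b X = 1.
Proof. by rewrite /shamsuddin /x1 !mderiv_var eqxx mulr0 addr0. Qed.

Lemma shamsuddin_x2 a b :
  shamsuddin a b Y = horner_alg X a * Y + horner_alg X b.
Proof. by rewrite /shamsuddin {3 4}/x2 !mderiv_var eqxx mulr1 add0r. Qed.

Definition to_polyY : {mpoly K[2]} -> {poly {poly K}} :=
  mmap (polyC \o polyC) (fun i : 'I_2 => if i == 0 then 'X%:P else 'X).
HB.instance Definition _ := GRing.RMorphism.on to_polyY.

Definition of_polyY : {poly {poly K}} -> {mpoly K[2]} :=
  horner_eval Y \o map_poly (horner_alg X).
HB.instance Definition _ := GRing.RMorphism.on of_polyY.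

Lemma to_polyY_alg k : to_polyY k%:A = k%:P%:P.
Proof. by rewrite alg_mpolyC /to_polyY mmapC. Qed.

Lemma to_polyY_x1 : to_polyY X = 'X%:P.
Proof. by rewrite /to_polyY mmapX mmap1U. Qed.

Lemma to_polyY_x2 : to_polyY Y = 'X.
Proof. by rewrite /to_polyY mmapX mmap1U. Qed.

Lemma of_polyYC (u : {poly K}) : of_polyY u%:P = horner_alg X u.
Proof. by rewrite /of_polyY /= map_polyC /horner_eval hornerC. Qed.

Lemma of_polyYX : of_polyY 'X = Y.
Proof. by rewrite /of_polyY /= map_polyX /horner_eval hornerX. Qed.

Lemma to_polyYK : cancel to_polyY of_polyY.
Proof.
apply: mpoly_gen_ind => [k|||p r|p r].
- by rewrite to_polyY_alg of_polyYC horner_algC.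
- by rewrite to_polyY_x1 of_polyYC horner_algX.
- by rewrite to_polyY_x2 of_polyYX.
- by move=> pK rK; rewrite !rmorphD /= pK rK.
- by move=> pK rK; rewrite !rmorphM /= pK rK.
Qed.

Lemma to_polyY_horner_alg r u :
  to_polyY (horner_alg r u) = (map_poly (polyC \o polyC) u).[to_polyY r].
Proof.
elim/poly_ind: u => [|u c IHu]; first by rewrite !rmorph0 horner0.
rewrite !(rmorphD, rmorphM) /= horner_algC horner_algX IHu.
by rewrite map_polyX map_polyC !hornerE to_polyY_alg.
Qed.

Lemma horner_polyCC u v :
  (map_poly (polyC \o polyC) u).[v%:P] = (u \Po v)%:P :> {poly {poly K}}.
Proof.
elim/poly_ind: u => [|u c IHu]; first by rewrite comp_poly0 rmorph0 horner0.
rewrite !(rmorphD, rmorphM) /= comp_polyX comp_polyC.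
by rewrite map_polyX map_polyC !hornerE IHu -polyCM -polyCD.
Qed.

Lemma to_polyY_horner_x1 u : to_polyY (horner_alg X u) = u%:P.
Proof.
by rewrite to_polyY_horner_alg to_polyY_x1 horner_polyCC comp_polyXr.
Qed.

Lemma of_polyYK : cancel of_polyY to_polyY.
Proof.
elim/poly_ind=> [|q u IHq]; first by rewrite !rmorph0.
rewrite !(rmorphD, rmorphM) /= IHq of_polyYX of_polyYC.
by rewrite to_polyY_x2 to_polyY_horner_x1.
Qed.

Lemma to_polyY_shamsuddin a b p :
  to_polyY (shamsuddin a b p) = shamsuddinY a b (to_polyY p).
Proof.
elim/mpoly_gen_ind: p => [k|||p r IHp IHr|p r IHp IHr].
- by rewrite shamsuddin_alg to_polyY_alg rmorph0 shamsuddinYC derivC.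
- by rewrite shamsuddin_x1 to_polyY_x1 rmorph1 shamsuddinYC derivX.
- rewrite shamsuddin_x2 to_polyY_x2 shamsuddinYX rmorphD rmorphM /=.
  by rewrite to_polyY_x2 !to_polyY_horner_x1.
- rewrite shamsuddinD [LHS]rmorphD [to_polyY (p + r)]rmorphD /=.
  by rewrite IHp IHr shamsuddinYD.
- rewrite shamsuddinM [LHS]rmorphD [to_polyY (p * r)]rmorphM !rmorphM /=.
  by rewrite IHp IHr shamsuddinYM.
Qed.

Lemma of_polyY_shamsuddin a b q :
  of_polyY (shamsuddinY a b q) = shamsuddin a b (of_polyY q).
Proof. by rewrite -{1}[q]of_polyYK -to_polyY_shamsuddin to_polyYK. Qed.

Lemma lrmorph_horner_alg (rho : {lrmorphism {mpoly K[2]} -> {mpoly K[2]}})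
    p (u : {poly K}) :
  rho (horner_alg p u) = horner_alg (rho p) u.
Proof.
elim/poly_ind: u => [|u c IHu]; first by rewrite !rmorph0.
by rewrite !(rmorphD, rmorphM) /= IHu !horner_algX !horner_algC rmorph_alg.
Qed.

Lemma lrmorph_eq (rho sigma : {lrmorphism {mpoly K[2]} -> {mpoly K[2]}}) :
  rho X = sigma X -> rho Y = sigma Y -> rho =1 sigma.
Proof.
move=> eX eY; apply: mpoly_gen_ind => // [k|p r ep er|p r ep er].
- by rewrite !rmorph_alg.
- by rewrite !rmorphD /= ep er.
- by rewrite !rmorphM /= ep er.
Qed.

Lemma lrmorph_commute a b (rho : {lrmorphism {mpoly K[2]} -> {mpoly K[2]}}) :
  rho (shamsuddin a b X) = shamsuddin a b (rho X) ->
  rho (shamsuddin a b Y) = shamsuddin a b (rho Y) ->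
  forall p, rho (shamsuddin a b p) = shamsuddin a b (rho p).
Proof.
move=> eX eY; apply: mpoly_gen_ind => // [k|p r ep er|p r ep er].
- by rewrite rmorph_alg !shamsuddin_alg rmorph0.
- by rewrite shamsuddinD [LHS]rmorphD [rho (p + r)]rmorphD shamsuddinD /= ep er.
- rewrite shamsuddinM [LHS]rmorphD [rho (p * r)]rmorphM shamsuddinM.
  by rewrite !rmorphM /= ep er.
Qed.

(** * The equation governs simplicity and automorphisms *)

(** The ideal of the curve y = h(x) is stable by [horner_shamsuddinY]. *)
Lemma solution_not_simple a b h :
  ode_solution a b h -> ~ simple_derivation (shamsuddin a b).
Proof.
move=> hP simpleD; pose I p := (to_polyY p).[h] = 0.
have II : is_ideal I.
  split=> [|p r Ip Ir|r p Ip]; rewrite /I.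
  - by rewrite rmorph0 horner0.
  - by rewrite rmorphD /= hornerD Ip Ir addr0.
  - by rewrite rmorphM /= hornerM Ip mulr0.
have SI : stable (shamsuddin a b) I.
  move=> p Ip.
  by rewrite /I to_polyY_shamsuddin (horner_shamsuddinY _ hP) Ip derivC.
case: (simpleD I II SI) => [I0|I1]; last first.
  by have /eqP := I1 1; rewrite /I rmorph1 hornerC oner_eq0.
have /I0 /(congr1 to_polyY) /eqP : I (Y - horner_alg X h).
  by rewrite /I rmorphB /= to_polyY_x2 to_polyY_horner_x1 !hornerE subrr.
by rewrite rmorphB /= to_polyY_x2 to_polyY_horner_x1 rmorph0 polyXsubC_eq0.
Qed.

(** A nonzero stable ideal, carried to K[x][y], is subject to
    [stable_descent]; excluded middle decides whether I is nonzero. *)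
Lemma no_solution_simple (charK0 : [pchar K] =i pred0) a b :
  no_ode_solution a b -> simple_derivation (shamsuddin a b).
Proof.
move=> ns I II SI.
case: (classic (exists p, I p /\ p != 0)) => [[p [Ip p0]]|I0]; last first.
  left=> p; split=> [Ip|->]; last exact: ideal_zero.
  by apply/eqP/negPn/negP=> p0; apply: I0; exists p.
right; pose J q := I (of_polyY q).
have IJ : is_ideal J.
  split=> [|q q' Jq Jq'|q q' Jq]; rewrite /J.
  - by rewrite rmorph0; apply: ideal_zero.
  - by rewrite rmorphD; apply: ideal_add.
  - by rewrite rmorphM; apply: ideal_mul.
have SJ : stable (shamsuddinY a b) J.
  by move=> q Jq; rewrite /J of_polyY_shamsuddin; apply: SI.
have Jp : J (to_polyY p) by rewrite /J to_polyYK.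
have q0 : to_polyY p != 0.
  by apply: contraNneq p0 => p0; rewrite -[p]to_polyYK p0 rmorph0.
case: (stable_descent charK0 IJ SJ Jp q0) => [|[h /ns//]].
by rewrite /J rmorph1 => I1 r; rewrite -[r]mulr1; apply: ideal_mul.
Qed.

(** In K[x][y], the images of x and y are determined by
    [derivative_one_translate] and then [semiconjugate_trivial]. *)
Lemma no_solution_commuting_id (charK0 : [pchar K] =i pred0) a b
    (rho : {lrmorphism {mpoly K[2]} -> {mpoly K[2]}}) :
  no_ode_solution a b ->
  (forall p, rho (shamsuddin a b p) = shamsuddin a b (rho p)) ->
  rho =1 id.
Proof.
move=> ns rhoD.
have [k fE] : exists k : K, to_polyY (rho X) = ('X + k%:P)%:P.
  apply: (derivative_one_translate charK0 ns).
  by rewrite -to_polyY_shamsuddin -rhoD shamsuddin_x1 !rmorph1.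
have [k0 gE] : k = 0 /\ to_polyY (rho Y) = 'X.
  apply: (semiconjugate_trivial charK0 ns).
  rewrite -to_polyY_shamsuddin -rhoD shamsuddin_x2 !(rmorphD, rmorphM) /=.
  by rewrite !lrmorph_horner_alg !to_polyY_horner_alg fE !horner_polyCC.
apply: (@lrmorph_eq rho idfun) => /=; apply: (can_inj to_polyYK).
  by rewrite fE k0 addr0 to_polyY_x1.
by rewrite gE to_polyY_x2.
Qed.

(** The automorphism is y |-> h + 2 (y - h) with x fixed; the factor could be
    any element of K other than 0 and 1, and 2 is one in characteristic 0. *)
Lemma solution_nontrivial_aut (charK0 : [pchar K] =i pred0) a b h :
  ode_solution a b h ->
  exists2 rho : {lrmorphism {mpoly K[2]} -> {mpoly K[2]}},
    in_Aut_D (shamsuddin a b) rho & rho Y <> Y.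
Proof.
move=> hP; pose H := horner_alg X h.
have two : 2%:R != 0 :> K by rewrite ((pcharf0P K).1 charK0).
pose rho : {lrmorphism {mpoly K[2]} -> {mpoly K[2]}} :=
  comp_mpoly [tuple X; Y + (Y - H)].
pose sigma : {lrmorphism {mpoly K[2]} -> {mpoly K[2]}} :=
  comp_mpoly [tuple X; 2%:R^-1 *: (Y + H)].
have rX : rho X = X by rewrite /rho /= /x1 comp_mpolyXU.
have rY : rho Y = Y + (Y - H) by rewrite /rho /= {1}/x2 comp_mpolyXU.
have sX : sigma X = X by rewrite /sigma /= /x1 comp_mpolyXU.
have sY : sigma Y = 2%:R^-1 *: (Y + H).
  by rewrite /sigma /= {1}/x2 comp_mpolyXU.
have rH u : rho (horner_alg X u) = horner_alg X u.
  by rewrite lrmorph_horner_alg rX.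
have sH u : sigma (horner_alg X u) = horner_alg X u.
  by rewrite lrmorph_horner_alg sX.
have half p : 2%:R^-1 *: (p + p) = p.
  by rewrite -mulr2n -scaler_nat scalerA mulVf ?scale1r.
clearbody rho sigma; exists rho; last first.
  move/(congr1 to_polyY)/eqP; rewrite rY -subr_eq0 rmorphD addrAC /= subrr add0r.
  by rewrite rmorphB /= to_polyY_x2 to_polyY_horner_x1 polyXsubC_eq0.
split.
  exists sigma.
    apply: (@lrmorph_eq (sigma \o rho) idfun) => /=; first by rewrite rX sX.
    rewrite rY !(rmorphD, rmorphN) /= sY sH -/H.
    by rewrite addrA -scalerDr half addrK.
  apply: (@lrmorph_eq (rho \o sigma) idfun) => /=; first by rewrite sX rX.
  by rewrite sY linearZ /= rmorphD /= rY rH -/H -addrA subrK half.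
have DH : shamsuddin a b H = horner_alg X a * H + horner_alg X b.
  apply: (can_inj to_polyYK); rewrite to_polyY_shamsuddin !(rmorphD, rmorphM) /=.
  by rewrite !to_polyY_horner_x1 shamsuddinYC hP polyCD polyCM.
apply: lrmorph_commute; first by rewrite rX shamsuddin_x1 rmorph1.
(* y - h is an eigenvector with eigenvalue a(x), which rho fixes. *)
have DB : shamsuddin a b (Y - H) = horner_alg X a * (Y - H).
  apply: (addIr (shamsuddin a b H)).
  by rewrite -shamsuddinD subrK DH shamsuddin_x2; ring.
rewrite rY shamsuddinD DB shamsuddin_x2 !(rmorphD, rmorphM) /= !rH rY; ring.
Qed.

End Transport.

Theorem theorem3p9 (K : fieldType) (charK0 : [pchar K] =i pred0)
    (a b : {poly K}) :
  simple_derivation (shamsuddin a b) <->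
  (forall rho : {lrmorphism {mpoly K[2]} -> {mpoly K[2]}},
     in_Aut_D (shamsuddin a b) rho <-> rho =1 id).
Proof.
split=> [simpleD rho | Aut_id].
  split=> [[_ rhoD] | rho_id].
    apply: (no_solution_commuting_id charK0) rhoD => h hP.
    exact: solution_not_simple hP simpleD.
  split=> [|p]; last by rewrite !rho_id.
  by exists id => p; rewrite rho_id.
apply: no_solution_simple => // h hP.
have [rho rhoD rhoY] := solution_nontrivial_aut charK0 hP.
by apply: rhoY; apply: (Aut_id rho).1.
Qed.
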